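(* Let $Y_1,\dots,Y_n$ be independent observations, $Y_i\sim f_{\theta_i}(y)$. Suppose that the density of $Y$ is of the form $f_\theta(y)\equiv f(y\mid\theta)=\exp(\theta y-\psi(\theta))$, $\theta\in\Omega\subseteq\mathbb R$, with respect to some dominating measure $\mu$. Let $\hat G$ be a GMLE, based on $Y_1,\dots,Y_n$, supported on the interior of the parameter set $\Omega$. Let $\eta(\theta)=E_\theta Y$. Then $$n\,E_{\hat G}\,\eta(\theta)=\sum_{i=1}^n Y_i .$$
   Context: Here $\psi(\theta)=\log\int e^{\theta y}\,d\mu(y)$ is the normalizing function, and $E_\theta Y=\int y\,f(y\mid\theta)\,d\mu(y)$. For a probability distribution $G$ on $\Omega$, $f_G(y)=\int f(y\mid\vartheta)\,dG(\vartheta)$ and $E_G\,\eta(\theta)=\int\eta\,dG$. GMLE (generalized maximum likelihood estimator): a probability distribution $\hat G$ that maximizes $\prod_{i=1}^n f_G(Y_i)$ over all probability distributions $G$ on $\Omega$. *)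

(* Defs.v *)
From HB Require Import structures.
From mathcomp Require Import all_boot all_order all_algebra.
From mathcomp Require Import all_classical all_reals all_analysis.

Set Implicit Arguments.
Unset Strict Implicit.
Unset Printing Implicit Defensive.

Import Order.TTheory GRing.Theory Num.Theory.
Import numFieldNormedType.Exports.

Local Open Scope classical_set_scope.
Local Open Scope ring_scope.
Local Open Scope ereal_scope.

Section exponential_family.
Context {R : realType}.
Variable mu : {measure set (measurableTypeR R) -> \bar R}.

Definition laplace (t : R) : \bar R := \int[mu]_y (expR (t * y))%:E.

Definition natural_space : set R := [set t | 0 < laplace t < +oo].

(* Only meaningful on [natural_space]; elsewhere [psi] takes the junk value 0. *)
Definition psi (t : R) : R := ln (fine (laplace t)).

Definition dens (t y : R) : R := expR (t * y - psi t).

Definition mean_value (t : R) : \bar R := \int[mu]_y (y * dens t y)%:E.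

(* The mixing measures below live on the whole real line and are concentrated
   on the parameter set, so the values of [dens] and [mean_value] outside the
   parameter set do not contribute to integrals over the whole line. *)
Definition mixdens (G : probability (measurableTypeR R) R) (y : R) : \bar R :=
  \int[G]_t (dens t y)%:E.

Definition likelihood (n : nat) (y : 'I_n -> R)
    (G : probability (measurableTypeR R) R) : \bar R :=
  \prod_(i < n) mixdens G (y i).

End exponential_family.

(* For measurable [A] this says [G A = 1]. *)
Definition concentrated_on {R : realType} (A : set R)
    (G : probability (measurableTypeR R) R) : Prop :=
  {ae G, forall t, A t}.

Definition is_gmle {R : realType}
    (mu : {measure set (measurableTypeR R) -> \bar R}) (Omega : set R)
    (n : nat) (y : 'I_n -> R) (G : probability (measurableTypeR R) R) : Prop :=
  concentrated_on Omega G /\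
  forall H : probability (measurableTypeR R) R,
    concentrated_on Omega H -> likelihood mu y H <= likelihood mu y G.

(* Restricting to subfamilies is the case where some [A i] are [setT]. *)
Definition mutually_independent {R : realType} {d : measure_display}
    {T : measurableType d} (P : probability T R) (n : nat)
    (Y : 'I_n -> {RV P >-> R}) : Prop :=
  forall A : 'I_n -> set (measurableTypeR R), (forall i, measurable (A i)) ->
    P (\bigcap_(i in [set: 'I_n]) (Y i @^-1` A i)) =
    \prod_(i < n) P (Y i @^-1` A i).

Definition has_density {R : realType} {d : measure_display}
    {T : measurableType d} (P : probability T R) (X : {RV P >-> R})
    (mu : {measure set (measurableTypeR R) -> \bar R}) (f : R -> R) : Prop :=
  forall A : set (measurableTypeR R), measurable A ->
    distribution P X A = \int[mu]_(y in A) (f y)%:E.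

(* Main.v *)
(* If [G] is a GMLE and [t] lies in [Omega], then [(1 - e) G + e \d_t] is a
   competitor; comparing the likelihoods as [e] tends to 0 gives
   [D(t) := \sum_i f(Y_i | t) / f_G(Y_i) <= n].  Since [D] integrates to [n]
   against [G], [D = n] holds [G]-almost everywhere, so almost every [t] in the
   interior is a maximum of [D] and [D'(t) = 0], which reads
   [n eta(t) = \sum_i Y_i f(Y_i | t) / f_G(Y_i)].  Integrating against [G]
   finishes the proof.  The derivative is replaced by a quadratic upper bound for
   the Laplace transform.  The null event is that some [Y_i] is a
   point [y] with \mu[y,+oo) = 0 or \mu(-oo,y] = 0: elsewhere
   [f(Y_i | t)] is bounded in [t], so the likelihood is finite. *)
Require Import Defs.
From HB Require Import structures.
From mathcomp Require Import all_boot all_order all_algebra.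
From mathcomp Require Import all_classical all_reals all_analysis.
From mathcomp Require Import measurable_realfun ring lra.

Set Implicit Arguments.
Unset Strict Implicit.
Unset Printing Implicit Defensive.

Import Order.TTheory GRing.Theory Num.Theory.
Import numFieldNormedType.Exports.

Local Open Scope classical_set_scope.
Local Open Scope ring_scope.
Local Open Scope ereal_scope.

(** * Measurability in the parameter of [psi], [dens] and [mean_value] *)

Lemma nondecreasing_emeasurable (R : realType) (f : R -> \bar R) :
  {homo f : s t / (s <= t)%R >-> s <= t} -> measurable_fun [set: R] f.
Proof.
move=> f_nd; apply: (measurability _ (ErealGenCInfty.measurableE R)) => //.
move=> _ [_ [r ->] <-]; rewrite setTI; apply: is_interval_measurable => s t /=.
rewrite !in_itv/= !andbT => fs _ u /andP[su _].
by rewrite in_itv/= andbT (le_trans fs)// f_nd.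
Qed.

Lemma nonincreasing_emeasurable (R : realType) (f : R -> \bar R) :
  {homo f : s t / (t <= s)%R >-> s <= t} -> measurable_fun [set: R] f.
Proof.
move=> f_ni; rewrite (_ : f = (f \o -%R) \o -%R); last first.
  by apply/funext => t /=; rewrite opprK.
apply: measurableT_comp => //; apply: nondecreasing_emeasurable => s t st /=.
by rewrite f_ni// lerN2.
Qed.

Section measurability.
Context {R : realType}.
Variable mu : {measure set (measurableTypeR R) -> \bar R}.

Lemma measurable_expRM (t : R) :
  measurable_fun [set: measurableTypeR R] (fun y : R => expR (t * y)).
Proof.
by apply: measurableT_comp => //; apply: measurable_funM.
Qed.

(** [mu] is an arbitrary measure, not assumed sigma-finite, so measurability is not drawn from
    Tonelli. Instead the integral is split at [y = 0]: on each half-line the integrand, hence the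
    integral, is monotone in [t]. *)
Lemma measurable_weighted_laplace (g : R -> R) :
  measurable_fun [set: measurableTypeR R] g -> (forall y, 0 <= g y)%R ->
  measurable_fun [set: measurableTypeR R]
    (fun t : R => \int[mu]_y (g y * expR (t * y))%:E).
Proof.
move=> mg g0.
have mge t : measurable_fun [set: measurableTypeR R] (fun y => (g y * expR (t * y))%:E).
  by apply/measurable_EFinP; apply: measurable_funM => //; exact: measurable_expRM.
have ge0 t y : 0 <= (g y * expR (t * y))%:E.
  by rewrite lee_fin mulr_ge0// expR_ge0.
pose A : set (measurableTypeR R) := `[0%R, +oo[%classic.
pose B : set (measurableTypeR R) := `]-oo, 0%R[%classic.
have mA : measurable A by exact: measurable_itv.
have mB : measurable B by exact: measurable_itv.
rewrite (_ : (fun t => _) = (fun t => \int[mu]_(y in A) (g y * expR (t * y))%:E +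
    \int[mu]_(y in B) (g y * expR (t * y))%:E)).
  apply: emeasurable_funD.
  - apply: nondecreasing_emeasurable => s t st.
    apply: ge0_le_integral => //; try exact: measurable_funTS.
    move=> y; rewrite /A/= in_itv/= andbT => y0.
    by rewrite lee_fin ler_wpM2l// ler_expR ler_wpM2r.
  - apply: nonincreasing_emeasurable => s t st.
    apply: ge0_le_integral => //; try exact: measurable_funTS.
    move=> y; rewrite /B/= in_itv/= => /ltW y0.
    by rewrite lee_fin ler_wpM2l// ler_expR ler_wnM2r.
apply/funext => t; rewrite -ge0_integral_setU//.
- congr (integral _ _ _); rewrite /A /B; apply/seteqP; split => //= y _.
  by rewrite /= !in_itv/= andbT; case: (leP 0%R y); [left|right].
- exact: measurable_funTS.
- by apply/disj_setPS => y [] /=; rewrite /A /B /= !in_itv/= andbT leNgt => /negP.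
Qed.

Lemma measurable_psi : measurable_fun [set: measurableTypeR R] (psi mu).
Proof.
apply: measurableT_comp; first exact: measurable_ln.
apply: measurableT_comp => //.
have := @measurable_weighted_laplace (cst 1%R) (measurable_cst _) (fun=> ler01).
by congr measurable_fun; apply/funext => t; apply: eq_integral => y _; rewrite mul1r.
Qed.

Lemma measurable_dens (y : R) :
  measurable_fun [set: measurableTypeR R] (fun t => dens mu t y).
Proof.
apply: measurableT_comp => //; apply: measurable_funB; last exact: measurable_psi.
exact: measurable_funM.
Qed.

(** The positive and negative parts of [y] are nonnegative weights, and the factor
    [expR (- psi mu t)] comes out of each integral for every [t], including those where [psi] is
    junk. *)
Lemma measurable_mean_value : measurable_fun [set: measurableTypeR R] (mean_value mu).
Proof.
pose p (y : R) := Num.max y 0%R; pose q (y : R) := Num.max (- y)%R 0%R.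
have mp : measurable_fun [set: measurableTypeR R] p by exact: measurable_maxr.
have mq : measurable_fun [set: measurableTypeR R] q.
  by apply: measurable_maxr => //; exact: measurableT_comp.
have p0 y : (0 <= p y)%R by rewrite le_max lexx orbT.
have q0 y : (0 <= q y)%R by rewrite le_max lexx orbT.
have E (r : R -> R) t : measurable_fun [set: measurableTypeR R] r -> (forall y, 0 <= r y)%R ->
    \int[mu]_y (r y * dens mu t y)%:E =
    (expR (- psi mu t))%:E * \int[mu]_y (r y * expR (t * y))%:E.
  move=> mr r0; rewrite -ge0_integralZl_EFin ?expR_ge0//.
  - by apply: eq_integral => y _; rewrite /dens expRD -EFinM mulrA mulrC.
  - by move=> y _; rewrite lee_fin mulr_ge0// expR_ge0.
  - by apply/measurable_EFinP; apply: measurable_funM => //; exact: measurable_expRM.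
have mexp : measurable_fun [set: measurableTypeR R] (fun t => (expR (- psi mu t))%:E).
  apply/measurable_EFinP; apply: measurableT_comp => //.
  by apply: measurableT_comp => //; exact: measurable_psi.
rewrite (_ : mean_value mu = fun t =>
   (expR (- psi mu t))%:E * \int[mu]_y (p y * expR (t * y))%:E -
   (expR (- psi mu t))%:E * \int[mu]_y (q y * expR (t * y))%:E).
  by apply: emeasurable_funB; apply: emeasurable_funM => //;
    exact: measurable_weighted_laplace.
apply/funext => t; rewrite -!E// /mean_value integralE; congr (_ - _).
  apply: eq_integral => y _; rewrite funeposE -EFin_max; congr EFin.
  by rewrite /p maxr_pMl ?expR_ge0// mul0r.
apply: eq_integral => y _; rewrite funenegE -EFinN -EFin_max; congr EFin.
by rewrite /q maxr_pMl ?expR_ge0// mul0r mulNr.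
Qed.

End measurability.

(** * Elementary inequalities replacing derivatives *)

Lemma linear_le_quadratic_le0 (R : realFieldType) (a C d : R) : (0 < d)%R ->
  (forall e, 0 < e < d -> a * e <= C * e ^+ 2)%R -> (a <= 0)%R.
Proof.
move=> d0 aC; rewrite leNgt; apply/negP => a0.
have C0 : (0 < `|C| + 1)%R by rewrite ltr_wpDl.
(* The first bound keeps [e] below [d]; the second forces [C * e <= a / 2 < a], a contradiction. *)
pose e : R := (Num.min (d / 2) (a / (2 * (`|C| + 1))))%R.
have e0 : (0 < e)%R by rewrite lt_min !divr_gt0// mulr_gt0.
have ed : (e < d)%R by rewrite gt_min ltr_pdivrMr// ltr_pMr// ltr1n.
have := aC e; rewrite e0 ed => /(_ isT).
rewrite expr2 mulrA ler_pM2r// leNgt => /negP; apply.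
have : (e <= a / (2 * (`|C| + 1)))%R by rewrite ge_min lexx orbT.
rewrite ler_pdivlMr ?mulr_gt0// => h.
have := ler_norm C; nra.
Qed.

(** First-order expansion of the likelihood ratio along a contamination path; the induction
    multiplies the remainder by one bounded factor and adds one cross term. *)
Lemma prod1D_expansion (R : realFieldType) (n : nat) (x : 'I_n -> R) :
  (exists C, forall e, 0 < e < 1 ->
    `|\prod_(i < n) (1 + e * x i) - 1 - e * \sum_(i < n) x i| <= C * e ^+ 2)%R.
Proof.
elim: n x => [|n IHn] x.
  by exists 0%R => e _; rewrite !big_ord0 mulr0 subrr subr0 normr0 mul0r.
have [C HC] := IHn (fun i => x (lift ord0 i)).
set S := (\sum_(i < n) x (lift ord0 i))%R in HC.
exists ((1 + `|x ord0|) * C + `|x ord0 * S|)%R => e e01.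
have := HC e e01; rewrite !big_ord_recl -/S.
set p := (\prod_(i < n) _)%R => pC.
rewrite (_ : _ - _ = (1 + e * x ord0) * (p - 1 - e * S) + x ord0 * S * e ^+ 2)%R; last by ring.
rewrite (le_trans (ler_normD _ _))// [leRHS]mulrDl lerD//; last first.
  by rewrite normrM (ger0_norm (sqr_ge0 e)).
rewrite normrM -mulrA ler_pM// (le_trans (ler_normD _ _))// normr1 lerD2l.
by case/andP: e01 => e0 e1; rewrite normrM ler_piMl// gtr0_norm// ltW.
Qed.

Lemma sum_le0_of_prod_le1 (R : realFieldType) (n : nat) (x : 'I_n -> R) :
  (forall e, 0 < e < 1 -> \prod_(i < n) (1 + e * x i) <= 1)%R ->
  (\sum_(i < n) x i <= 0)%R.
Proof.
move=> x1; have [C HC] := prod1D_expansion x.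
apply: (@linear_le_quadratic_le0 _ _ C 1%R) => // e e01.
have := HC e e01; have := x1 e e01; rewrite ler_norml => ? /andP[? _]; lra.
Qed.

(** Multiplying [1 - u <= expR (- u)] by [expR u] gives [expR u - 1 <= u * expR u]. For [u >= 0]
    this is applied twice; for [u < 0] it is combined with [1 + u <= expR u]. *)
Lemma expR_le_quadratic (R : realType) (u : R) :
  (expR u <= 1 + u + u ^+ 2 * expR `|u|)%R.
Proof.
have hN := expR_ge1Dx (- u)%R; have h := expR_ge1Dx u.
have e0 := expR_gt0 u.
have uE : (expR u - 1 <= u * expR u)%R.
  have : (expR u * (1 - u) <= expR u * expR (- u))%R by rewrite ler_pM2l.
  rewrite -expRD subrr expR0; lra.
have [u0|u0] := leP 0%R u.
  rewrite ger0_norm//; nra.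
have e1 : (1 <= expR `|u|)%R by apply: le_trans (expR_ge1Dx _); rewrite lerDl.
nra.
Qed.

Lemma expR_norm_le (R : realType) (u : R) : (expR `|u| <= expR u + expR (- u))%R.
Proof.
by case: (ger0P u) => _; rewrite ?lerDl ?lerDr expR_ge0.
Qed.

Lemma norm_le_expR (R : realType) (d y : R) : (0 < d)%R ->
  (`|y| <= d^-1 * (expR (d * y) + expR (- (d * y))))%R.
Proof.
move=> d0; rewrite mulrC ler_pdivlMr// -[X in (_ * X)%R](gtr0_norm d0) -normrM mulrC.
apply: le_trans (expR_norm_le _); apply: le_trans (expR_ge1Dx _); lra.
Qed.

(** After factoring out [expR (t * y)], the quadratic bound at [s * y] leaves
    [y ^+ 2 * expR |s * y|] to control. The exponent [|d * y|] is spent in thirds: two absorb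
    [y ^+ 2], which produces the constant 9, and the last absorbs [expR |s * y|], hence the
    condition on [s]. *)
Lemma expR_shift_le (R : realType) (d s t y : R) : (0 < d)%R -> (`|s| <= d / 3)%R ->
  (expR ((t + s) * y) <= expR (t * y) + s * (y * expR (t * y)) +
    s ^+ 2 * (9 / d ^+ 2) * (expR ((t + d) * y) + expR ((t - d) * y)))%R.
Proof.
move=> d0 sd.
rewrite [X in (expR X)]mulrDl expRD.
rewrite (_ : expR (_ * y) + _ + _ = expR (t * y) * (1 + s * y +
   s ^+ 2 * (9 / d ^+ 2) * (expR (d * y) + expR (- (d * y)))))%R; last first.
  by rewrite [((t + d) * y)%R]mulrDl [((t - d) * y)%R]mulrBl !expRD; ring.
rewrite ler_pM2l ?expR_gt0//; apply: (le_trans (expR_le_quadratic _)).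
rewrite lerD2l exprMn -[leLHS]mulrA -[leRHS]mulrA ler_wpM2l ?sqr_ge0//.
apply: (@le_trans _ _ (9 / d ^+ 2 * expR `|d * y|)%R); last first.
  by rewrite ler_wpM2l ?divr_ge0 ?sqr_ge0// expR_norm_le.
set z := `|d * y|%R; have z0 : (0 <= z)%R by rewrite normr_ge0.
have -> : (y ^+ 2 = 9 / d ^+ 2 * (z / 3) ^+ 2)%R.
  rewrite /z exprMn real_normK ?num_real//; field; lra.
rewrite -[leLHS]mulrA ler_wpM2l ?divr_ge0 ?sqr_ge0//.
have zE : (z / 3 <= expR (z / 3))%R by apply: le_trans (expR_ge1Dx _); lra.
have syz : (`|s * y| <= z / 3)%R.
  by rewrite /z !normrM (gtr0_norm d0) mulrAC ler_wpM2r.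
have -> : expR z = (expR (z / 3) ^+ 2 * expR (z / 3))%R.
  rewrite -expRM_natl -expRD; congr expR; lra.
apply: ler_pM; rewrite ?sqr_ge0 ?expR_ge0 ?ler_expR//.
by rewrite lerXn2r// nnegrE ?expR_ge0 ?divr_ge0.
Qed.

(** * Laplace transform, bounds on the density, and null tails *)

Section laplace_theory.
Context {R : realType}.
Variable mu : {measure set (measurableTypeR R) -> \bar R}.

Lemma laplaceE (t : R) : natural_space mu t -> laplace mu t = (expR (psi mu t))%:E.
Proof.
move=> /andP[L0 Loo]; rewrite /psi lnK ?fineK//.
  by rewrite ge0_fin_numE ?Loo// ltW.
by rewrite posrE fine_gt0// L0.
Qed.

Lemma dens_gt0 (t y : R) : (0 < dens mu t y)%R.
Proof. exact: expR_gt0. Qed.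

(** Restricting the Laplace integral to [A] gives [expR (t * y) * mu A <= expR (psi mu t)]. This
    also forces [mu A] to be finite, so dividing is legitimate. *)
Lemma dens_le_inv (A : set (measurableTypeR R)) (y : R) :
  measurable A -> 0 < mu A ->
  forall t, natural_space mu t -> (forall u, A u -> t * y <= t * u)%R ->
    (dens mu t y <= (fine (mu A))^-1)%R.
Proof.
move=> mA A0 t nt tA.
have h : (expR (t * y))%:E * mu A <= (expR (psi mu t))%:E.
  rewrite -laplaceE// -integral_cst// /laplace.
  apply: (@le_trans _ _ (\int[mu]_(u in A) (expR (t * u))%:E)).
    apply: ge0_le_integral => //.
    - by move=> u _; rewrite lee_fin expR_ge0.
    - by apply/measurable_EFinP/measurable_funTS; exact: measurable_expRM.
    - by move=> u Au; rewrite lee_fin ler_expR tA.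
  apply: ge0_subset_integral => //.
  by apply/measurable_EFinP; exact: measurable_expRM.
have Afin : mu A \is a fin_num.
  rewrite ge0_fin_numE// ltey; apply/eqP => Aoo.
  by move: h; rewrite Aoo gt0_muley ?lte_fin ?expR_gt0.
move: h A0; rewrite -(fineK Afin) -EFinM lee_fin lte_fin => h A0.
by rewrite /dens expRD expRN -[leRHS]mul1r ler_pdivlMr// mulrAC ler_pdivrMr ?expR_gt0// mul1r.
Qed.

(** The right tail bounds the density for [t >= 0], the left tail for [t <= 0]. *)
Lemma dens_bounded (y : R) : 0 < mu `[y, +oo[%classic -> 0 < mu `]-oo, y]%classic ->
  exists C, forall t, natural_space mu t -> (dens mu t y <= C)%R.
Proof.
move=> y0 y1.
exists (Num.max (fine (mu `[y, +oo[%classic))^-1 (fine (mu `]-oo, y]%classic))^-1)%R.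
move=> t nt; rewrite le_max; apply/orP; have [t0|/ltW t0] := leP 0%R t.
- left; apply: (dens_le_inv (A := `[y, +oo[%classic)) => //.
  by move=> u; rewrite /= in_itv/= andbT => yu; rewrite ler_wpM2l.
- right; apply: (dens_le_inv (A := `]-oo, y]%classic)) => //.
  by move=> u; rewrite /= in_itv/= => uy; rewrite ler_wnM2l.
Qed.

(* A point of the null set not covered by a null tail with rational endpoint is
   unique, because a rational lies strictly between any two points. *)
Lemma negligible_null_tails (tl : R -> set (measurableTypeR R)) :
  (forall y, measurable (tl y)) -> (forall y, tl y y) ->
  (forall y z, y < z -> exists q : rat,
     (tl (ratr q) `<=` tl y /\ tl (ratr q) z) \/
     (tl (ratr q) `<=` tl z /\ tl (ratr q) y))%R ->
  mu.-negligible [set y | mu (tl y) = 0].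
Proof.
move=> mtl tly tlq.
have sub0 q y : tl (ratr q) `<=` tl y -> mu (tl y) = 0 -> mu (tl (ratr q)) = 0.
  by move=> sub; apply: subset_measure0.
(* The null tails with rational endpoint, enumerated by [pickle]; their union is negligible. *)
pose F (k : nat) : set (measurableTypeR R) :=
  if unpickle k is Some q then
    if pselect (mu (tl (ratr (q : rat))) = 0) then tl (ratr q) else set0
  else set0.
have F0 : mu.-negligible (\bigcup_k F k).
  apply: negligible_bigcup => k; rewrite /F; case: unpickle => [q|]; last exact: negligible_set0.
  by case: pselect => [q0|q0]; [exact/negligibleP|exact: negligible_set0].
have inF q y : mu (tl (ratr q)) = 0 -> tl (ratr q) y -> (\bigcup_k F k) y.
  move=> q0 qy; exists (pickle q); first exact: I.
  by rewrite /F pickleK; case: pselect.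
have [[m [m0 mF]]|] := pselect (exists m, mu (tl m) = 0 /\ ~ (\bigcup_k F k) m).
  apply: (@negligibleS _ _ _ _ (tl m `|` \bigcup_k F k)); last first.
    by apply: negligibleU => //; exact/negligibleP.
  move=> y /= y0; have [/tlq [q [[s i]|[s i]]]|/tlq [q [[s i]|[s i]]]|->] := ltgtP y m.
  - by exfalso; apply: mF; apply: inF i; apply: sub0 y0.
  - by right; apply: inF i; apply: sub0 m0.
  - by right; apply: inF i; apply: sub0 m0.
  - by exfalso; apply: mF; apply: inF i; apply: sub0 y0.
  - by left; exact: tly.
move=> noex; apply: negligibleS F0 => y /= y0; apply: contrapT => yF.
by apply: noex; exists y.
Qed.

Lemma ae_tails_gt0 : {ae mu, forall y,
  0 < mu `[y, +oo[%classic /\ 0 < mu `]-oo, y]%classic}.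
Proof.
have up : mu.-negligible [set y : R | mu `[y, +oo[%classic = 0].
  apply: (negligible_null_tails (tl := fun y => `[y, +oo[%classic)).
  - by move=> y; exact: measurable_itv.
  - by move=> y; rewrite /= in_itv/= lexx.
  move=> y z yz; have [q] := rat_in_itvoo yz; rewrite in_itv/= => /andP[yq qz].
  exists q; left; split; last by rewrite /= in_itv/= andbT ltW.
  by move=> u; rewrite /= !in_itv/= !andbT => /(le_trans (ltW yq)).
have down : mu.-negligible [set y : R | mu `]-oo, y]%classic = 0].
  apply: (negligible_null_tails (tl := fun y => `]-oo, y]%classic)).
  - by move=> y; exact: measurable_itv.
  - by move=> y; rewrite /= in_itv/= lexx.
  move=> y z yz; have [q] := rat_in_itvoo yz; rewrite in_itv/= => /andP[yq qz].
  exists q; right; split; last by rewrite /= in_itv/= ltW.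
  by move=> u; rewrite /= !in_itv/= => uq; rewrite (le_trans uq)// ltW.
apply: negligibleS (negligibleU up down) => y /= /not_andP[] /negP;
  rewrite lt0e measure_ge0 andbT negbK => /eqP; [by left|by right].
Qed.

Lemma measurable_dens_obs (t : R) :
  measurable_fun [set: measurableTypeR R] (dens mu t).
Proof.
apply: measurableT_comp => //; apply: measurable_funB; last exact: measurable_cst.
exact: measurable_funM.
Qed.

(** The law of [X] is absolutely continuous with respect to [mu], so preimages of [mu]-null sets are
    [P]-null. *)
Lemma ae_has_density d (T : measurableType d) (P : probability T R) (X : {RV P >-> R})
    (f : R -> R) (Q : set R) :
  measurable_fun [set: measurableTypeR R] f -> has_density X mu f ->
  {ae mu, forall y, Q y} -> {ae P, forall w, Q (X w)}.
Proof.
move=> mf fX [A [mA A0 QA]]; exists (X @^-1` A); split.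
- by rewrite -[_ @^-1` _]setTI; exact: measurable_funPT.
- have := fX A mA; rewrite /distribution /pushforward => ->.
  by apply: null_set_integral => //; apply/measurable_EFinP; exact: measurable_funTS.
- by move=> w /= Qw; apply: QA.
Qed.

End laplace_theory.

(** * The contaminated mixing measure [(1 - e) G + e \d_t] *)

Section contamination.
Context {R : realType} (e : R) (e0 : (0 <= e)%R) (e1 : (0 <= 1 - e)%R).
Variables (G : probability (measurableTypeR R) R) (t : measurableTypeR R).

Definition contaminate : set (measurableTypeR R) -> \bar R :=
  measure_add (mscale (NngNum e1) G) (mscale (NngNum e0) (dirac t)).

HB.instance Definition _ := Measure.on contaminate.

Let contaminate_setT : contaminate setT = 1.
Proof.
rewrite /contaminate measure_addE /mscale/=.
by rewrite [X in _ * X + _]probability_setT [X in _ + _ * X]diracT !mule1 -EFinD subrK.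
Qed.

HB.instance Definition _ := Measure_isProbability.Build _ _ _ contaminate contaminate_setT.

Lemma integral_contaminate (f : measurableTypeR R -> \bar R) :
  measurable_fun [set: measurableTypeR R] f -> (forall x, 0 <= f x) ->
  \int[contaminate]_x f x = (1 - e)%:E * \int[G]_x f x + e%:E * f t.
Proof.
move=> mf f0; rewrite ge0_integral_measure_add// !ge0_integral_mscale//.
by rewrite integral_dirac// diracT mul1e.
Qed.

Lemma concentrated_on_contaminate (A : set R) :
  concentrated_on A G -> A t -> concentrated_on A contaminate.
Proof.
(* [B] is a [G]-null cover of the complement of [A]. Removing [t], which lies in [A], keeps it a
   cover and makes it null for the point mass as well. *)
move=> [B [mB B0 AB]] At; exists (B `\ t); split.
- by apply: measurableD => //; exact: measurable_set1.
- have mBt : measurable (B `\ t) by apply: measurableD => //; exact: measurable_set1.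
  change (contaminate (B `\ t) = 0).
  rewrite /contaminate measure_addE /mscale/=.
  have GBt : G (B `\ t) = 0 by apply: (subset_measure0 mBt mB) => // x [].
  rewrite [X in _ * X + _]GBt [X in _ + _ * X]diracE memNset ?mule0 ?add0e//.
  by move=> -[_]; apply.
- by move=> x Ax; split; [exact: AB|move=> /= xt; apply: Ax; rewrite /= xt].
Qed.

End contamination.

(** * Score inequality, stationarity, and integration against the GMLE *)

Section gmle.
Context {R : realType}.
Variables (mu : {measure set (measurableTypeR R) -> \bar R}) (Omega : set R).
Hypothesis hOmega : Omega `<=` natural_space mu.

Lemma mixdens_fin_gt0 (G : probability (measurableTypeR R) R) (y : R) :
  concentrated_on Omega G ->
  0 < mu `[y, +oo[%classic -> 0 < mu `]-oo, y]%classic ->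
  0 < mixdens mu G y < +oo.
Proof.
move=> GOmega y0 y1; have [C HC] := dens_bounded y0 y1.
have aeG : Filter (nbhs (almost_everywhere G)) := ae_filter_ringOfSetsType G.
have md : measurable_fun [set: measurableTypeR R] (fun t => (dens mu t y)%:E).
  by apply/measurable_EFinP; exact: measurable_dens.
have d0 t : 0 <= (dens mu t y)%:E by rewrite lee_fin ltW// dens_gt0.
apply/andP; split.
  rewrite lt0e integral_ge0 ?andbT//; apply/eqP => m0.
  have : ae_eq G setT (fun t => (dens mu t y)%:E) (cst 0).
    apply/ae_eq_integral_abs => //; rewrite -[RHS]m0.
    by apply: eq_integral => t _; rewrite gee0_abs.
  move=> [A [mA A0 subA]].
  (* The density is positive everywhere, so a vanishing integral would make the whole line
     [G]-null. *)
  have AT : A = setT.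
    apply/seteqP; split => // t _; apply: subA => /= /(_ I) [] /eqP.
    by rewrite gt_eqF// dens_gt0.
  have := probability_setT G; rewrite -AT [X in X = _]A0 => /esym/eqP.
  by rewrite onee_eq0.
apply: (@le_lt_trans _ _ (\int[G]_t (Num.max C 0)%:E)).
  apply: ae_ge0_le_integral => //.
    by move=> t _; rewrite lee_fin le_max lexx orbT.
  by apply: filterS GOmega => t Ot _; rewrite lee_fin le_max HC//; exact: hOmega.
by rewrite integral_cst// [X in _ * X]probability_setT mule1 ltry.
Qed.

(** Contamination at [t] multiplies the [i]-th mixture density by [1 + e * x i] with
    [x i = dens mu t (y i) / f i - 1]. Maximality bounds the product of these factors by 1 for all
    small [e], so the first-order term is nonpositive. *)
Lemma gmle_score_le (n : nat) (y : 'I_n -> R) (G : probability (measurableTypeR R) R)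
    (f : 'I_n -> R) :
  is_gmle mu Omega y G -> (forall i, mixdens mu G (y i) = (f i)%:E) ->
  (forall i, 0 < f i)%R ->
  forall t, Omega t -> (\sum_(i < n) dens mu t (y i) / f i <= n%:R)%R.
Proof.
move=> [GOmega Gmax] fE f0 t Ot.
suff : (\sum_(i < n) (dens mu t (y i) / f i - 1) <= 0)%R.
  by rewrite sumrB sumr_const card_ord subr_le0.
apply: sum_le0_of_prod_le1 => e /andP[e0 e1].
have e0' := ltW e0; have e1' : (0 <= 1 - e)%R by rewrite subr_ge0 ltW.
have := Gmax (contaminate e0' e1' G t) (concentrated_on_contaminate _ _ GOmega Ot).
rewrite /likelihood.
under [leLHS]eq_bigr => i _.
  rewrite (_ : mixdens _ _ _ = (f i * (1 + e * (dens mu t (y i) / f i - 1)))%:E).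
    over.
  rewrite /mixdens integral_contaminate//.
  - have := fE i; rewrite /mixdens => ->; rewrite -!EFinM -EFinD; congr EFin.
    by field; rewrite gt_eqF.
  - by apply/measurable_EFinP; exact: measurable_dens.
  - by move=> u; rewrite lee_fin ltW// dens_gt0.
under [leRHS]eq_bigr do rewrite fE.
rewrite !prodEFin lee_fin big_split/= ger_pMr//.
by apply: prodr_gt0.
Qed.

Lemma integrable_expR (t : R) : natural_space mu t ->
  mu.-integrable setT (EFin \o (fun y => expR (t * y))).
Proof.
move=> /andP[_ Loo]; apply/integrableP; split.
  by apply/measurable_EFinP; exact: measurable_expRM.
rewrite (le_lt_trans _ Loo)// /laplace le_eqVlt; apply/orP; left; apply/eqP.
by apply: eq_integral => y _ /=; rewrite ger0_norm// expR_ge0.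
Qed.

(** Integrates [expR_shift_le] over [y]. Here [M] is the integral of [y * expR (t * y)], the
    derivative of the Laplace transform at [t]; finiteness of the transform at [t + d] and [t - d]
    makes it and the remainder integrable. *)
Lemma laplace_quadratic (t d : R) : (0 < d)%R -> natural_space mu t ->
  natural_space mu (t + d)%R -> natural_space mu (t - d)%R ->
  exists M K, mean_value mu t = (M / expR (psi mu t))%:E /\
    forall s, natural_space mu (t + s)%R -> (`|s| <= d / 3 ->
      expR (psi mu (t + s)) <= expR (psi mu t) + s * M + K * s ^+ 2)%R.
Proof.
move=> d0 nt ntd ntNd.
pose f0 (y : measurableTypeR R) := expR (t * y).
pose f1 (y : measurableTypeR R) := (y * expR (t * y))%R.
pose f2 (y : measurableTypeR R) := (expR ((t + d) * y) + expR ((t - d) * y))%R.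
have if0 : mu.-integrable setT (EFin \o f0) by exact: integrable_expR.
have if2 : mu.-integrable setT (EFin \o f2).
  rewrite (_ : EFin \o f2 = (EFin \o (fun y => expR ((t + d) * y))) \+
    (EFin \o (fun y => expR ((t - d) * y))))//.
  by apply: integrableD => //; exact: integrable_expR.
have mf1 : measurable_fun [set: measurableTypeR R] f1.
  by apply: measurable_funM => //; exact: measurable_expRM.
have if1 : mu.-integrable setT (EFin \o f1).
  apply: le_integrable (integrableZl measurableT d^-1%R if2) => //.
    exact/measurable_EFinP.
  move=> y _; rewrite /f1 /f2 /= lee_fin normrM (ger0_norm (expR_ge0 _)).
  rewrite (le_trans _ (ler_norm _))//.
  have -> : (expR ((t + d) * y) + expR ((t - d) * y) =
      (expR (d * y) + expR (- (d * y))) * expR (t * y))%R.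
    by rewrite [((t + d) * y)%R]mulrDl [((t - d) * y)%R]mulrBl !expRD; ring.
  by rewrite mulrA ler_wpM2r ?expR_ge0// norm_le_expR.
have fin1 := integrable_fin_num measurableT if1.
have fin2 := integrable_fin_num measurableT if2.
exists (fine (\int[mu]_y (f1 y)%:E)), (9 / d ^+ 2 * fine (\int[mu]_y (f2 y)%:E))%R.
split.
  rewrite EFinM fineK// -expRN muleC -integralZl//.
  by apply: eq_integral => y _; rewrite /dens expRD /f1 -EFinM mulrA mulrC.
move=> s nts sd; rewrite -lee_fin -laplaceE//.
have if1s := integrableZl measurableT s if1.
have if2s := integrableZl measurableT (s ^+ 2 * (9 / d ^+ 2))%R if2.
have -> : (expR (psi mu t) + s * fine (\int[mu]_y (f1 y)%:E) +
    9 / d ^+ 2 * fine (\int[mu]_y (f2 y)%:E) * s ^+ 2)%:E =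
  \int[mu]_y ((f0 y)%:E + s%:E * (f1 y)%:E + (s ^+ 2 * (9 / d ^+ 2))%:E * (f2 y)%:E).
  rewrite integralD//; last exact: integrableD.
  rewrite integralD// !integralZl// [X in X + _ + _](laplaceE nt).
  rewrite -{2}(fineK fin1) -{2}(fineK fin2) -!EFinM -!EFinD; congr EFin.
  by ring.
apply: le_integral => //; first exact: integrable_expR.
  by apply: integrableD => //; exact: integrableD.
move=> y _; rewrite -!EFinM -!EFinD lee_fin; exact: expR_shift_le.
Qed.

Lemma score_maximum_stationary (n : nat) (y f : 'I_n -> R) (t : R) :
  (forall i, 0 < f i)%R -> interior Omega t ->
  (forall u, Omega u -> \sum_(i < n) dens mu u (y i) / f i <= n%:R)%R ->
  (\sum_(i < n) dens mu t (y i) / f i = n%:R)%R ->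
  exists m, mean_value mu t = m%:E /\
    (n%:R * m = \sum_(i < n) y i * (dens mu t (y i) / f i))%R.
Proof.
(* [L] and [Ls] are the Laplace transform at [t] and [t + s], and [A] is the sum of
   [expR ((t + s) * y i) / f i]. The score bound caps [A] from above, convexity of [expR] bounds it
   from below by its tangent, and [laplace_quadratic] bounds [Ls]. *)
have combine (N L Ls A s B M K : R) : (A <= N * Ls -> N * L + s * B <= A ->
    N * Ls <= N * (L + s * M + K * s ^+ 2) -> s * (B - N * M) <= N * K * s ^+ 2)%R.
  by lra.
move=> f0 /nbhs_ballP[r /= r0 ballO] score_le score_eq.
have near s : (`|s| <= r / 2)%R -> Omega (t + s)%R.
  move=> sr; apply: ballO; rewrite /ball/= opprD addNKr normrN.
  by rewrite (le_lt_trans sr)// ltr_pdivrMr// ltr_pMr// ltr1n.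
have d0 : (0 < r / 2)%R by rewrite divr_gt0.
have nt : Omega t by rewrite -[t]addr0; apply: near; rewrite normr0 ltW.
have [||||M [K [mvE quad]]] := @laplace_quadratic t (r / 2)%R => //.
- exact: hOmega.
- by apply/hOmega/near; rewrite gtr0_norm.
- by apply/hOmega/near; rewrite normrN gtr0_norm.
exists (M / expR (psi mu t))%R; split => //.
pose S := (\sum_(i < n) y i * (expR (t * y i) / f i))%R.
have densE u z (g : R) : (dens mu u z / g = expR (u * z) / g / expR (psi mu u))%R.
  by rewrite /dens expRD expRN mulrAC.
have sumE u : (\sum_(i < n) dens mu u (y i) / f i =
    (\sum_(i < n) expR (u * y i) / f i) / expR (psi mu u))%R.
  by rewrite mulr_suml; apply: eq_bigr => i _.
have eq_t : (\sum_(i < n) expR (t * y i) / f i = n%:R * expR (psi mu t))%R.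
  by rewrite -score_eq (sumE t) (mulfVK (lt0r_neq0 (expR_gt0 _))).
have ineq s : (`|s| <= r / 2 / 3 -> s * (S - n%:R * M) <= n%:R * K * s ^+ 2)%R.
  move=> sr3; have sr : (`|s| <= r / 2)%R by rewrite (le_trans sr3)// ler_pdivrMr// ler_peMr ?(ltW d0)// ler1n.
  have := score_le _ (near _ sr); rewrite sumE ler_pdivrMr ?expR_gt0// => h1.
  have h2 := quad s (hOmega (near _ sr)) sr3.
  have h3 : (n%:R * expR (psi mu t) + s * S <= \sum_(i < n) expR ((t + s) * y i) / f i)%R.
    rewrite -eq_t mulr_sumr -big_split/=; apply: ler_sum => i _.
    rewrite !mulrA -mulrDl ler_wpM2r ?invr_ge0 ?(ltW (f0 i))// mulrDl expRD.
    rewrite -[X in (X + _)%R]mul1r -mulrDl mulrC ler_wpM2l ?expR_ge0//.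
    exact: expR_ge1Dx.
  exact: combine h1 h3 (ler_wpM2l (ler0n R n) h2).
(* Since [s] may take either sign, taking [s = e] and [s = - e] gives the two inequalities. *)
have SE : (S = n%:R * M)%R.
  apply/eqP; rewrite -subr_eq0 eq_le -oppr_le0; apply/andP; split.
  - apply: (@linear_le_quadratic_le0 _ _ (n%:R * K)%R (r / 2 / 3)%R); first by rewrite divr_gt0.
    move=> e /andP[e0 er]; rewrite mulrC ineq// gtr0_norm// ltW//.
  - apply: (@linear_le_quadratic_le0 _ _ (n%:R * K)%R (r / 2 / 3)%R); first by rewrite divr_gt0.
    move=> e /andP[e0 er]; rewrite mulNr mulrC -mulNr -sqrrN ineq//.
    by rewrite normrN gtr0_norm// ltW.
rewrite mulrA -SE /S mulr_suml; apply: eq_bigr => i _.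
by rewrite densE -[LHS]mulrA.
Qed.

Lemma gmle_mean_value (n : nat) (y : 'I_n -> R) (G : probability (measurableTypeR R) R) :
  (forall i, 0 < mu `[y i, +oo[%classic /\ 0 < mu `]-oo, y i]%classic) ->
  is_gmle mu Omega y G -> concentrated_on (interior Omega) G ->
  n%:R%:E * \int[G]_t mean_value mu t = (\sum_(i < n) y i)%:E.
Proof.
move=> tails gmle Gint; have GOmega := gmle.1.
have aeG : Filter (nbhs (almost_everywhere G)) := ae_filter_ringOfSetsType G.
pose f i := fine (mixdens mu G (y i)).
have mix i : 0 < mixdens mu G (y i) < +oo.
  by have [y0 y1] := tails i; exact: mixdens_fin_gt0.
have fE i : mixdens mu G (y i) = (f i)%:E.
  have /andP[m0 moo] := mix i; by rewrite fineK// ge0_fin_numE// ltW.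
have f0 i : (0 < f i)%R by rewrite -lte_fin -fE; have /andP[] := mix i.
have score_le := gmle_score_le gmle fE f0.
have mr i : measurable_fun [set: measurableTypeR R] (fun t => (dens mu t (y i) / f i)%R).
  by apply: measurable_funM => //; exact: measurable_dens.
have ir1 i : \int[G]_t (dens mu t (y i) / f i)%:E = 1.
  under eq_integral do rewrite mulrC EFinM.
  rewrite ge0_integralZl_EFin ?invr_ge0 ?(ltW (f0 i))//.
  - by have := fE i; rewrite /mixdens => ->; rewrite -EFinM mulVf// gt_eqF.
  - by move=> t _; rewrite lee_fin ltW// dens_gt0.
  - by apply/measurable_EFinP; exact: measurable_dens.
have ir i : G.-integrable setT (fun t => (dens mu t (y i) / f i)%:E).
  apply/integrableP; split; first exact/measurable_EFinP.
  under eq_integral do rewrite gee0_abs ?lee_fin ?divr_ge0 ?(ltW (f0 _)) ?expR_ge0//.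
  by rewrite ir1 ltry.
(* Used with [c = 1] to show that the score integrates to [n], and with [c = y] for the final
   identity. *)
have wsum (c : 'I_n -> R) :
    \int[G]_t (\sum_(i < n) c i * (dens mu t (y i) / f i))%:E = (\sum_(i < n) c i)%:E.
  under eq_integral do rewrite -sumEFin.
  under eq_integral do under eq_bigr do rewrite EFinM.
  rewrite integral_sum//; last by move=> i; exact: integrableZl.
  by rewrite -sumEFin; apply: eq_bigr => i _; rewrite integralZl// ir1 mule1.
have msum (c : 'I_n -> R) : measurable_fun [set: measurableTypeR R]
    (fun t => \sum_(i < n) c i * (dens mu t (y i) / f i))%R.
  by apply: measurable_sum => i; exact: measurable_funM.
have score_ae : {ae G, forall t, (\sum_(i < n) dens mu t (y i) / f i = n%:R)%R}.
  (* [gap] is nonnegative [G]-almost everywhere and has integral 0, hence vanishes almost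
     everywhere. The factor 1 matches the form of [wsum]. *)
  pose gap t : R := (n%:R - \sum_(i < n) 1 * (dens mu t (y i) / f i))%R.
  have mgap : measurable_fun [set: measurableTypeR R] (EFin \o gap).
    by apply/measurable_EFinP; apply: measurable_funB.
  have gap_ge0 t : Omega t -> (0 <= gap t)%R.
    by move=> Ot; rewrite subr_ge0; under eq_bigr do rewrite mul1r; exact: score_le.
  have : ae_eq G setT (EFin \o gap) (cst 0).
    apply/ae_eq_integral_abs => //.
    transitivity (\int[G]_t (gap t)%:E).
      apply: ae_eq_integral => //; first exact: measurableT_comp.
      by apply: filterS GOmega => t Ot _ /=; rewrite ger0_norm// gap_ge0.
    transitivity (\int[G]_t (n%:R%:E -
        (\sum_(i < n) 1 * (dens mu t (y i) / f i))%:E)) => //.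
    rewrite integralB//.
    + rewrite wsum integral_cst// [X in _ * X]probability_setT mule1.
      by rewrite sumr_const [#|_|]card_ord -EFinB subrr.
    + exact: finite_measure_integrable_cst.
    + apply/integrableP; split; first exact/measurable_EFinP.
      have sum_ge0 t : (0 <= \sum_(i < n) 1 * (dens mu t (y i) / f i))%R.
        by apply: sumr_ge0 => i _; rewrite mul1r divr_ge0 ?expR_ge0// ltW.
      under eq_integral do rewrite gee0_abs ?lee_fin//.
      by rewrite wsum ltry.
  apply: filterS => t /(_ I) [] /eqP; rewrite subr_eq0 => /eqP ->.
  by apply: eq_bigr => i _; rewrite mul1r.
(* For [n = 0] both sides are 0, since [0 * x = 0] even for infinite [x]; otherwise stationarity can
   be divided by [n]. *)
have [n0|n0] := eqVneq n 0%N.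
  by rewrite big1 ?mul0e ?n0 ?mul0e// => -[i i_n]; exfalso; move: i_n; rewrite n0.
have nR : (n%:R != 0 :> R)%R by rewrite pnatr_eq0.
have -> : \int[G]_t mean_value mu t =
    \int[G]_t ((n%:R^-1)%:E * (\sum_(i < n) y i * (dens mu t (y i) / f i))%:E).
  apply: ae_eq_integral => //.
  - exact: measurable_mean_value.
  - by apply: emeasurable_funM => //; exact/measurable_EFinP.
  - apply: filterS2 Gint score_ae => t tO tn _.
    have [m [-> nm]] := score_maximum_stationary f0 tO score_le tn.
    by rewrite -nm -EFinM mulrA mulVf// mul1r.
rewrite integralZl//.
  by rewrite wsum -!EFinM mulrA divff// mul1r.
rewrite (_ : (fun t => _) = fun t => \sum_(i < n) (y i)%:E * (dens mu t (y i) / f i)%:E).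
  by apply: integrable_sum => // i _; exact: integrableZl.
by apply/funext => t; rewrite -sumEFin.
Qed.

End gmle.

Theorem theorem3 (R : realType)
  (mu : {measure set (measurableTypeR R) -> \bar R})
  (Omega : set R) (hOmega : Omega `<=` natural_space mu)
  (d : measure_display) (T : measurableType d) (P : probability T R)
  (n : nat) (theta : 'I_n -> R) (htheta : forall i, Omega (theta i))
  (Y : 'I_n -> {RV P >-> R})
  (hindep : mutually_independent Y)
  (hdens : forall i, has_density (Y i) mu (dens mu (theta i))) :
  {ae P, forall w, forall G : probability (measurableTypeR R) R,
    is_gmle mu Omega (fun i => Y i w) G ->
    concentrated_on (interior Omega) G ->
    n%:R%:E * \int[G]_t mean_value mu t = (\sum_(i < n) Y i w)%:E}.
Proof.
(* The exceptional event depends only on the observations, so one null event serves every GMLE [G]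
   at once. *)
have /filter_forall : forall i, {ae P, forall w,
    0 < mu `[Y i w, +oo[%classic /\ 0 < mu `]-oo, Y i w]%classic}.
  move=> i; apply: (ae_has_density
    (Q := [set y | 0 < mu `[y, +oo[%classic /\ 0 < mu `]-oo, y]%classic])
    _ (hdens i) (ae_tails_gt0 mu)).
  exact: measurable_dens_obs.
apply: filterS => w tails G gmle Gint.
exact: (gmle_mean_value hOmega).
Qed.
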